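(* Let $p$ be a prime number, $n\ge 1$, $q=p^n$, $\mathbb{K}=F_q$ the finite field with $q$ elements, and let $\mathcal{A}$ be the set of all hyperplanes through the origin in $F_q^2$. For a nonnegative integer $k$ put $\theta_{q^k}=x^{q^k}\partial_x+y^{q^k}\partial_y$. Let $i$ be a positive integer. For each $H\in\mathcal{A}$, fix $\alpha_H\in S_1$ satisfying $\ker(\alpha_H)=H$, and let $j_H$ be an integer such that $0\le j_H\le q^{i+1}-q^i$. Let $\alpha=\prod_{H\in\mathcal{A}}\alpha_H^{j_H}$. Let $\mu:\mathcal{A}\to\mathbb{Z}_{>0}$ be the map such that $\mu(H)=q^i+j_H$ for each $H\in\mathcal{A}$. Then $\{\alpha\cdot\theta_{q^i},\ \theta_{q^{i+1}}\}$ is a basis for $D(\mathcal{A},\mu)$.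
   Context: Let $\mathbb{K}$ be a field, $V=\mathbb{K}^2$ with coordinates $x,y$, and $S=\mathbb{K}[x,y]=\bigoplus_{i\ge 0}S_i$ graded by degree, so $S_1$ is the space of linear forms. A multiarrangement $(\mathcal{A},\mu)$ is a finite collection $\mathcal{A}$ of hyperplanes through the origin (i.e. lines through the origin) in $V$ with a map $\mu:\mathcal{A}\to\mathbb{Z}_{>0}$; set $\mu(H)=0$ for hyperplanes $H\notin\mathcal{A}$ through the origin. The module of logarithmic vector fields $D(\mathcal{A},\mu)$ is the $S$-module of all derivations $\theta=f\partial_x+g\partial_y$ with $f,g\in S$ such that $\theta(\alpha)$ lies in the ideal $(\alpha^{\mu(\ker(\alpha))})$ of $S$ for each $\alpha\in S_1\setminus\{0\}$. ''Basis'' means basis as an $S$-module. *)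

(* Defs.v *)
From HB Require Import structures.
From mathcomp Require Import all_boot all_order all_algebra.
From mathcomp Require Import finmap mpoly.

Set Implicit Arguments.
Unset Strict Implicit.
Unset Printing Implicit Defensive.

Import GRing.Theory.
Local Open Scope ring_scope.

Section Basis.
Variables (R : comNzRingType) (M : lmodType R).

Definition submod_basis (D : M -> Prop) (n : nat) (b : 'I_n -> M) : Prop :=
  (forall v : M, D v <-> exists c : 'I_n -> R, v = \sum_(i < n) c i *: b i)
  /\ (forall c : 'I_n -> R, \sum_(i < n) c i *: b i = 0 -> forall i, c i = 0).

End Basis.

Section LogarithmicVectorFields.
Variable K : fieldType.

Notation V := 'rV[K]_2.
Notation S := {mpoly K[2]}.

Definition hyperplane (H : {vspace V}) : bool := \dim H == 1%N.

Record multiarrangement := Multiarrangement {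
  arr : {fset {vspace V}};
  arr_hyperplane : forall H, H \in arr -> hyperplane H;
  mult : arr -> nat;
  mult_gt0 : forall H, (0 < mult H)%N
}.

Arguments mult : clear implicits.

Definition ext_mult (A : multiarrangement) (H : {vspace V}) : nat :=
  if insub H is Some H' then mult A H' else 0%N.

(* The function on V defined by f, with coordinates x = 'X_0 and y = 'X_1. *)
Definition evalV (f : S) (v : V) : K^o := f.@[fun i => v 0 i].

(* Only meaningful for linear forms, since [linfun] agrees with its argument
   only when the latter is linear; see [mem_form_ker]. *)
Definition form_ker (a : S) : {vspace V} := lker (linfun (evalV a)).

(* The row (f, g) stands for the derivation f d/dx + g d/dy of S. *)
Definition derivation_app (theta : 'rV[S]_2) (h : S) : S :=
  \sum_(i < 2) theta 0 i * h^`M(i).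

Definition logder (A : multiarrangement) (theta : 'rV[S]_2) : Prop :=
  forall a : S, a \is 1.-homog -> a != 0 ->
    exists h : S, derivation_app theta a = h * a ^+ ext_mult A (form_ker a).

Definition theta_pow (m : nat) : 'rV[S]_2 := \row_(i < 2) 'X_i ^+ m.

Lemma evalV_linear (a : S) : a \is 1.-homog -> linear (evalV a).
Proof.
move=> /dhomogP ha c u v; rewrite /evalV !mevalE scaler_sumr -big_split /=.
apply: eq_big_seq => m /ha /eqP /mdeg1P[i /eqP ->].
have prodU (w : V) : \prod_(j < 2) w 0 j ^+ U_(i)%MM j = w 0 i.
  rewrite (bigD1 i) //= mnm1E eqxx expr1 big1 ?mulr1 // => j ji.
  by rewrite mnm1E eq_sym (negPf ji) expr0.
by rewrite !prodU !mxE mulrDr /GRing.scale /= mulrCA.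
Qed.

Lemma mem_form_ker (a : S) (v : V) :
  a \is 1.-homog -> (v \in form_ker a) = (evalV a v == 0).
Proof.
move=> ha; pose L := GRing.isLinear.Build _ _ _ _ (evalV a) (evalV_linear ha).
pose f : {linear V -> K^o} := HB.pack (evalV a) L.
by rewrite memv_ker -[evalV a]/(f : V -> K^o) lfunE.
Qed.

End LogarithmicVectorFields.

Arguments mult {K}.

(* Main.v *)
Require Import Defs.
From mathcomp Require Import all_boot all_order all_algebra.
From mathcomp Require Import finmap mpoly.
From mathcomp Require Import fraction finfield pgroup abelian ring.

Set Implicit Arguments.
Unset Strict Implicit.
Unset Printing Implicit Defensive.

Import GRing.Theory.
Local Open Scope ring_scope.

(** Write S for F[x, y], P = q ^ i and Q = q ^ i.+1. The elements of F are fixed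
    by the q-th power map, which is additive on S, so theta_P and theta_Q send a
    linear form a to a ^+ P and a ^+ Q ([theta_pow_linform]). As
    P + j H <= Q, and as every nonzero linear form is proportional to exactly
    one alpha H, both proposed generators are logarithmic.

    Conversely, let v = (f, g) be logarithmic. By Cramer's rule
    ([cramer_span]), v is a combination of alpha theta_P and theta_Q as soon as
    D = x ^+ P * y ^+ Q - y ^+ P * x ^+ Q divides det (theta_P, v) and
    alpha * D divides det (v, theta_Q). If a = alpha H, then a ^+ P divides
    theta_P a and v a, and a ^+ (P + j H) divides v a and theta_Q a. A
    power of a dividing the values on a of two derivations divides their
    determinant, because that determinant is, up to a nonzero scalar, a
    combination of the two values ([det_divides]). So the first determinant is
    divisible by every (alpha H) ^+ P, and the second one by every
    (alpha H) ^+ (P + j H). Nonzero linear forms are prime ([linform_prime])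
    and the alpha H are pairwise not associated, hence the products of these powers
    divide the determinants ([prod_prime_powers_divides]).

    It remains to compare D with the product of the (alpha H) ^+ P. By
    additivity of the P-th power, D is the P-th power of the Moore determinant
    x * y ^+ q - y * x ^+ q ([Moore_det_exp]), and that is, up to sign, the
    product of one linear form for each line of the plane ([prod_line_form]),
    which divides the product of the alpha H. Finally D is nonzero, which also
    gives the freeness of the two generators ([cramer_free]). *)

(** * Divisibility and prime elements in a domain *)

Section Divisibility.
Variable R : idomainType.
Implicit Types d h k : R.

Definition divides d h : Prop := exists k, h = k * d.

Definition prime_elt d : Prop :=
  [/\ d != 0, ~ divides d 1
    & forall h k, divides d (h * k) -> divides d h \/ divides d k].

Lemma divides0 d : divides d 0.
Proof. by exists 0; rewrite mul0r. Qed.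

Lemma dividesM {d h} k : divides d h -> divides d (k * h).
Proof. by case=> c ->; exists (k * c); rewrite mulrA. Qed.

Lemma dividesB {d h k} : divides d h -> divides d k -> divides d (h - k).
Proof. by move=> [a ->] [b ->]; exists (a - b); rewrite mulrBl. Qed.

Lemma dividesD {d h k} : divides d h -> divides d k -> divides d (h + k).
Proof. by move=> [a ->] [b ->]; exists (a + b); rewrite mulrDl. Qed.

Lemma divides_trans {d h k} : divides d h -> divides h k -> divides d k.
Proof. by move=> dh [a ->]; apply: dividesM. Qed.

Lemma dividesX {d h} n : divides d h -> divides (d ^+ n) (h ^+ n).
Proof. by case=> a ->; exists (a ^+ n); rewrite exprMn. Qed.

Lemma divides_exp2l d m n : (m <= n)%N -> divides (d ^+ m) (d ^+ n).
Proof. by move=> le_mn; exists (d ^+ (n - m)); rewrite -exprD subnK. Qed.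

Lemma divides_prod (I : finType) (f : I -> R) (i : I) :
  divides (f i) (\prod_j f j).
Proof. by rewrite (bigD1 i) //= mulrC; eexists. Qed.

(** By induction on e: if d does not divide m, each factor d of k * m comes from
    k and can be cancelled. *)
Lemma prime_power_cancel d e k (m : R) :
  prime_elt d -> ~ divides d m -> divides (d ^+ e) (k * m) ->
  divides (d ^+ e) k.
Proof.
move=> [d0 _ dM] dm; elim: e k => [|e IHe] k; first by exists k; rewrite mulr1.
case=> c kmE.
have [|[k' kE]|//] := dM k m.
  by exists (c * d ^+ e); rewrite kmE exprSr mulrA.
have /IHe[c' k'E] : divides (d ^+ e) (k' * m).
  by exists c; apply: (mulIf d0); rewrite -[RHS]mulrA -exprSr -kmE kE; ring.
by exists c'; rewrite kE k'E exprSr mulrA.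
Qed.

Lemma prime_divides_prod (I : eqType) (s : seq I) (f : I -> R) (e : I -> nat)
    d :
  prime_elt d -> divides d (\prod_(i <- s) f i ^+ e i) ->
  exists2 i, i \in s & divides d (f i).
Proof.
move=> [_ d1 dM]; elim: s => [|i s IHs]; first by rewrite big_nil.
rewrite big_cons => /dM[dfi|/IHs[j js dfj]]; last first.
  by exists j => //; rewrite in_cons js orbT.
exists i; first exact: mem_head.
by elim: (e i) dfi => [//|n IHn]; rewrite exprS => /dM[].
Qed.

(** Pairwise coprimality without gcds: the quotient of h by the powers treated
    so far is still divisible by the next power, since f i divides none of the
    other primes. *)
Lemma prod_prime_powers_divides (I : finType) (f : I -> R) (e : I -> nat) h :
  (forall i, prime_elt (f i)) ->
  (forall i j, divides (f i) (f j) -> i = j) ->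
  (forall i, divides (f i ^+ e i) h) ->
  divides (\prod_i f i ^+ e i) h.
Proof.
move=> f_prime f_inj f_div.
suff: forall s, uniq s -> divides (\prod_(i <- s) f i ^+ e i) h.
  by apply; apply: index_enum_uniq.
elim=> [_|i s IHs /= /andP[is_ /IHs[k hE]]].
  by exists h; rewrite big_nil mulr1.
have [||k' kE] := prime_power_cancel (e := e i) (k := k)
    (m := \prod_(j <- s) f j ^+ e j) (f_prime i).
- move=> /(prime_divides_prod (f_prime i))[j js /f_inj ij].
  by rewrite ij js in is_.
- by rewrite -hE.
by exists k'; rewrite big_cons hE kE mulrA.
Qed.

End Divisibility.

(** * Two-by-two linear systems over a domain *)

Lemma ord2P (P : 'I_2 -> Prop) : P 0 -> P 1 -> forall i, P i.
Proof.
move=> P0 P1 [[|[|//]] lt_i2].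
  by rewrite (_ : Ordinal _ = 0) //; apply: val_inj.
by rewrite (_ : Ordinal _ = 1) //; apply: val_inj.
Qed.

Lemma sum_ord2 (V : nmodType) (f : 'I_2 -> V) : \sum_(i < 2) f i = f 0 + f 1.
Proof.
by rewrite big_ord_recl big_ord1; congr (_ + f _); apply: val_inj.
Qed.

Section Cramer.
Variable R : idomainType.

(** The coefficients are the two determinants obtained by replacing u or w by v,
    divided by the determinant of (u, w); the factor a, which scales the first
    vector, is absorbed in the second divisibility hypothesis. *)
Lemma cramer_span (a : R) (u w v : 'rV[R]_2) :
  u 0 0 * w 0 1 - u 0 1 * w 0 0 != 0 ->
  divides (u 0 0 * w 0 1 - u 0 1 * w 0 0) (u 0 0 * v 0 1 - u 0 1 * v 0 0) ->
  divides (a * (u 0 0 * w 0 1 - u 0 1 * w 0 0))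
          (v 0 0 * w 0 1 - v 0 1 * w 0 0) ->
  exists c0 c1, v = c0 *: (a *: u) + c1 *: w.
Proof.
set D := u 0 0 * w 0 1 - u 0 1 * w 0 0 => D0 [c1 uvE] [c0 vwE].
exists c0, c1; apply/rowP; apply: ord2P; rewrite !mxE; apply: (mulfI D0).
  transitivity (u 0 0 * (c0 * (a * D)) + w 0 0 * (c1 * D)); last by ring.
  by rewrite -uvE -vwE /D; ring.
transitivity (u 0 1 * (c0 * (a * D)) + w 0 1 * (c1 * D)); last by ring.
by rewrite -uvE -vwE /D; ring.
Qed.

Lemma cramer_free (c0 c1 : R) (u w : 'rV[R]_2) :
  u 0 0 * w 0 1 - u 0 1 * w 0 0 != 0 -> c0 *: u + c1 *: w = 0 ->
  c0 = 0 /\ c1 = 0.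
Proof.
set D := u 0 0 * w 0 1 - u 0 1 * w 0 0 => D0 uw0.
have := congr1 (fun r : 'rV[R]_2 => r 0 0) uw0; rewrite !mxE => E0.
have := congr1 (fun r : 'rV[R]_2 => r 0 1) uw0; rewrite !mxE => E1.
split; apply: (mulIf D0); rewrite mul0r.
  transitivity (w 0 1 * (c0 * u 0 0 + c1 * w 0 0)
                - w 0 0 * (c0 * u 0 1 + c1 * w 0 1)); first by rewrite /D; ring.
  by rewrite E0 E1 !mulr0 subr0.
transitivity (u 0 0 * (c0 * u 0 1 + c1 * w 0 1)
              - u 0 1 * (c0 * u 0 0 + c1 * w 0 0)); first by rewrite /D; ring.
by rewrite E0 E1 !mulr0 subr0.
Qed.

End Cramer.

(** * Linear forms in two variables *)

Section LinearForms.
Variable F : fieldType.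
Notation S := {mpoly F[2]}.

Definition linform (a b : F) : S := a *: 'X_0 + b *: 'X_1.

Lemma linformP (h : S) : h \is 1.-homog -> exists a b, h = linform a b.
Proof.
move=> /dhomogP h_homog; rewrite (mpolyE h) big_seq.
elim/big_ind: _ => [|_ _ [a [b ->]] [c [d ->]]|m /h_homog/eqP/mdeg1P[i /eqP->]].
- by exists 0, 0; rewrite /linform !scale0r addr0.
- by exists (a + c), (b + d); rewrite /linform !scalerDl addrACA.
move: i; apply: ord2P; [exists h@_U_(0), 0 | exists 0, h@_U_(1)];
by rewrite /linform scale0r ?addr0 ?add0r.
Qed.

Lemma linform_homog a b : linform a b \is 1.-homog.
Proof.
by apply: rpredD; apply: rpredZ; rewrite dhomogX; apply/eqP; exact: mdeg1.
Qed.

Lemma linform_eval a b (v : 'I_2 -> F) :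
  (linform a b).@[v] = a * v 0 + b * v 1.
Proof. by rewrite mevalD !mevalZ !mevalXU. Qed.

Lemma linform_neq0 a b : (linform a b != 0) = ((a != 0) || (b != 0)).
Proof.
apply/idP/idP; last first.
  apply: contraTT; rewrite negbK => /eqP ab0.
  have := linform_eval a b (fun i => (i == 0)%:R).
  have := linform_eval a b (fun i => (i == 1)%:R).
  by rewrite ab0 !meval0 /= !mulr1 !mulr0 add0r addr0 => <- <-; rewrite eqxx.
apply: contraNT; rewrite negb_or !negbK => /andP[/eqP-> /eqP->].
by rewrite /linform !scale0r addr0.
Qed.

(** The condition c * b = d * a says that the second form vanishes at (- b, a),
    which spans the kernel of the first. *)
Lemma linform_divides_linform a b c d :
  linform a b != 0 -> c * b = d * a -> divides (linform a b) (linform c d).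
Proof.
rewrite linform_neq0 /linform => /orP[a0|b0] cbda.
  exists (c / a)%:MP; rewrite mul_mpolyC scalerDr !scalerA divfK //.
  by congr (_ + _ *: _); rewrite mulrAC cbda mulfK.
exists (d / b)%:MP; rewrite mul_mpolyC scalerDr !scalerA divfK //.
by congr (_ *: _ + _); rewrite mulrAC -cbda mulfK.
Qed.

(** Modulo d, a polynomial depends only on the classes of the variables. *)
Lemma subst_congr (d : S) (lq : 2.-tuple S) (h : S) :
  (forall i, divides d ('X_i - tnth lq i)) -> divides d (h - (h \mPo lq)).
Proof.
move=> dX.
have congrM (u u' v v' : S) : divides d (u - u') -> divides d (v - v') ->
    divides d (u * v - u' * v').
  move=> du dv; rewrite (_ : _ - _ = v * (u - u') + u' * (v - v')); last first.
    by ring.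
  by apply: dividesD; apply: dividesM.
elim/mpolyind: h => [|c m h _ _ IHh].
  by rewrite comp_mpoly0 subr0; apply: divides0.
rewrite comp_mpolyD opprD addrACA; apply: dividesD => //.
rewrite comp_mpolyZ -scalerBr -mul_mpolyC; apply: dividesM.
rewrite comp_mpolyX mpolyXE_id.
elim/big_ind2: _ => [|u v u' v'|i _]; first by rewrite subrr; apply: divides0.
  exact: congrM.
elim: (m i) => [|n IHn]; first by rewrite subrr; apply: divides0.
by rewrite !exprS; apply: congrM.
Qed.

(** Solving a x + b y = 0 for a variable whose coefficient is nonzero gives a
    ring morphism from S to itself that kills the form and is the identity
    modulo it ([subst_congr]). So the multiples of the form are the kernel of a
    morphism to a domain. *)
Lemma linform_prime a b : linform a b != 0 -> prime_elt (linform a b).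
Proof.
move=> ab0.
suff [lq lq_ab lq_X] : exists2 lq : 2.-tuple S,
    linform a b \mPo lq = 0
    & forall i, divides (linform a b) ('X_i - tnth lq i).
  have divP h : divides (linform a b) h <-> h \mPo lq = 0.
    split=> [[k ->]|h0]; first by rewrite rmorphM /= lq_ab mulr0.
    by have := subst_congr h lq_X; rewrite h0 subr0.
  split=> // [/divP/eqP|h k /divP/eqP]; first by rewrite rmorph1 oner_eq0.
  by rewrite rmorphM mulf_eq0 => /orP[]/eqP/divP; [left|right].
move: (ab0); rewrite linform_neq0 => /orP[a0|b0].
- exists [tuple - (b / a) *: 'X_1; 'X_1].
    rewrite comp_mpolyD !comp_mpolyZ !comp_mpolyXU /= scalerA mulrN mulrCA.
    by rewrite mulfV // mulr1 scaleNr addNr.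
  apply: ord2P; rewrite (tnth_nth 0) /=; last by rewrite subrr; apply: divides0.
  exists (a^-1)%:MP; rewrite mul_mpolyC scalerDr !scalerA mulVf // scale1r.
  by rewrite scaleNr opprK mulrC.
- exists [tuple 'X_0; - (a / b) *: 'X_0].
    rewrite comp_mpolyD !comp_mpolyZ !comp_mpolyXU /= scalerA mulrN mulrCA.
    by rewrite mulfV // mulr1 scaleNr addrN.
  apply: ord2P; rewrite (tnth_nth 0) /=.
    by rewrite subrr; apply: divides0.
  exists (b^-1)%:MP; rewrite mul_mpolyC scalerDr !scalerA mulVf // scale1r.
  by rewrite scaleNr opprK mulrC addrC.
Qed.

(** Multiplied by a, or by b, the determinant is a combination of the two linear
    expressions assumed divisible by d; one of these scalars is invertible. *)
Lemma det_divides a b (d u1 u2 w1 w2 : S) : linform a b != 0 ->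
  divides d (a *: u1 + b *: u2) -> divides d (a *: w1 + b *: w2) ->
  divides d (u1 * w2 - u2 * w1).
Proof.
rewrite linform_neq0 -!mul_mpolyC => /orP[a0|b0] du dw.
  rewrite -[_ - _]scale1r -(mulVf a0) -scalerA -mul_mpolyC; apply: dividesM.
  rewrite -mul_mpolyC.
  rewrite (_ : _ * _ = w2 * (a%:MP * u1 + b%:MP * u2)
                       - u2 * (a%:MP * w1 + b%:MP * w2)); last by ring.
  by apply: dividesB; apply: dividesM.
rewrite -[_ - _]scale1r -(mulVf b0) -scalerA -mul_mpolyC; apply: dividesM.
rewrite -mul_mpolyC.
rewrite (_ : _ * _ = u1 * (a%:MP * w1 + b%:MP * w2)
                     - w1 * (a%:MP * u1 + b%:MP * u2)); last by ring.
by apply: dividesB; apply: dividesM.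
Qed.

Lemma derivation_appD (theta eta : 'rV[S]_2) a :
  derivation_app (theta + eta) a =
  derivation_app theta a + derivation_app eta a.
Proof.
rewrite /derivation_app -big_split.
by apply: eq_bigr => k _; rewrite mxE mulrDl.
Qed.

Lemma derivation_appZ c (theta : 'rV[S]_2) a :
  derivation_app (c *: theta) a = c * derivation_app theta a.
Proof.
by rewrite /derivation_app mulr_sumr; apply: eq_bigr => k _; rewrite mxE mulrA.
Qed.

Lemma derivation_linform (theta : 'rV[S]_2) a b :
  derivation_app theta (linform a b) = a *: theta 0 0 + b *: theta 0 1.
Proof.
rewrite /derivation_app sum_ord2 /linform !mderivD !mderivZ !mderivX !mnmE /=.
rewrite !scale0r !scaler0 addr0 add0r !scale1r.
have UU i : (U_(i) - U_(i) = 0 :> 'X_{1..2})%MM.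
  by apply/mnmP => k; rewrite !mnmE subnn.
by rewrite !UU mpolyX0 !alg_mpolyC ![_ * _%:MP]mulrC !mul_mpolyC.
Qed.

Lemma form_kerP a b (v : 'rV[F]_2) :
  (v \in form_ker (linform a b)) = (a * v 0 0 + b * v 0 1 == 0).
Proof. by rewrite mem_form_ker ?linform_homog // /evalV linform_eval. Qed.

Lemma form_ker_line a b : linform a b != 0 ->
  form_ker (linform a b) = <[(\row_(k < 2) if k == 0 then - b else a)%R]>%VS.
Proof.
rewrite linform_neq0 => ab0; apply/vspaceP => v; rewrite form_kerP.
apply/eqP/vlineP => [|[k ->]]; last by rewrite !mxE /=; ring.
move=> /eqP; rewrite addr_eq0 => /eqP v0.
case/orP: ab0 => [a0|b0].
  exists (v 0 1 / a); apply/rowP; apply: ord2P; rewrite !mxE /=.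
    by apply: (mulfI a0); rewrite v0; field.
  by field.
exists (- (v 0 0 / b)); apply/rowP; apply: ord2P; rewrite !mxE /=.
  by field.
by apply: (mulfI b0); rewrite -[LHS]opprK -v0; field.
Qed.

Lemma form_ker_hyperplane (a : S) :
  a \is 1.-homog -> hyperplane (form_ker a) = (a != 0).
Proof.
move=> /linformP[c [d ->]]; rewrite /hyperplane.
have [cd0|cd0] := eqVneq (linform c d) 0; last first.
  rewrite form_ker_line // dim_vline eqb1; apply/negP => /eqP v0.
  move: cd0; rewrite linform_neq0.
  have := congr1 (fun w : 'rV[F]_2 => w 0 0) v0; rewrite !mxE /= => d0.
  have := congr1 (fun w : 'rV[F]_2 => w 0 1) v0; rewrite !mxE /= => c0.
  by rewrite -(oppr_eq0 d) d0 c0 eqxx.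
suff -> : form_ker (linform c d) = fullv by rewrite dimvf /dim /=.
apply/vspaceP => v; rewrite memvf mem_form_ker ?linform_homog //.
by rewrite cd0 /evalV meval0 eqxx.
Qed.

Lemma form_ker_divides (a h : S) :
  a \is 1.-homog -> a != 0 -> h \is 1.-homog -> h != 0 ->
  divides a h <-> form_ker a = form_ker h.
Proof.
move=> a_lin a0 h_lin h0; split=> [[k hE]|ker_ah].
  apply/eqP; rewrite eqEdim; apply/andP; split.
    apply/subvP => v; rewrite !mem_form_ker // hE /evalV mevalM => /eqP->.
    by rewrite mulr0.
  by rewrite (eqP (_ : hyperplane (form_ker a))) ?form_ker_hyperplane //
     (eqP (_ : hyperplane (form_ker h))) ?form_ker_hyperplane.
have [c [d aE]] := linformP a_lin; have [c' [d' hE]] := linformP h_lin.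
rewrite aE hE in a0 ker_ah *; apply: linform_divides_linform => //.
have := memv_line (\row_(k < 2) (if k == 0 then - d else c)).
rewrite -form_ker_line // ker_ah form_kerP !mxE /= mulrN addrC subr_eq0.
by move=> /eqP.
Qed.

Lemma ext_mult_val (A : multiarrangement F) (H : arr A) :
  ext_mult A (val H) = mult A H.
Proof. by rewrite /ext_mult valK. Qed.

End LinearForms.

(** * Powers of the Frobenius map and the Moore determinant *)

Section FiniteField.
Variable F : finFieldType.
Notation S := {mpoly F[2]}.
Notation q := #|F|.

Lemma expf_card_exp k (x : F) : x ^+ (q ^ k) = x.
Proof.
by elim: k => [|k IHk]; rewrite ?expr1 // expnSr exprM IHk expf_card.
Qed.

(** This makes the q ^ k -th power map additive on S. *)
Lemma pnat_card_exp k : [pchar S].-nat (q ^ k)%N.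
Proof.
have [p p_prime pF] := finPcharP F.
have pS : p \in [pchar S] by apply: (rmorph_pchar (@mpolyC 2 F)).
rewrite (eq_pnat _ (pcharf_eq pS)) pnatX; apply/orP; left.
by have := abelem_pgroup (fin_ring_pchar_abelem pF); rewrite /pgroup cardsT.
Qed.

Lemma linform_exp k a b :
  a *: 'X_0 ^+ (q ^ k) + b *: 'X_1 ^+ (q ^ k) = (linform a b) ^+ (q ^ k) :> S.
Proof.
rewrite /linform exprDn_pchar ?pnat_card_exp // !exprZn.
by rewrite !expf_card_exp.
Qed.

Lemma theta_pow_linform k (a : S) : a \is 1.-homog ->
  derivation_app (theta_pow F (q ^ k)) a = a ^+ (q ^ k).
Proof.
by move=> /linformP[c [d ->]]; rewrite derivation_linform !mxE linform_exp.
Qed.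

(** Representatives of the linear forms up to scalars: y, and x - c y for each
    c; [None] is the point at infinity of the projective line. *)
Definition line_form (o : option F) : S :=
  if o is Some c then linform 1 (- c) else linform 0 1.

(** The homogenization of the identity that X ^ q - X is the product of the
    X - c: evaluate it at x / y in the fraction field of S, and multiply by
    y ^+ q.+1. *)
Lemma prod_line_form :
  \prod_o line_form o = 'X_0 ^+ q * 'X_1 - 'X_0 * 'X_1 ^+ q.
Proof.
rewrite (bigD1 None) //= (reindex_omap Some id) /=; last by case.
rewrite (eq_bigl xpredT) => [|c]; last by rewrite eqxx.
have y0 : tofrac ('X_1 : S) != 0.
  have := linform_neq0 (0 : F) 1; rewrite oner_eq0 orbT /linform.
  by rewrite scale0r add0r scale1r tofrac_eq0.
pose iota : {rmorphism F -> {fraction S}} := @tofrac S \o @mpolyC 2 F.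
set x := tofrac ('X_0 : S); set y := tofrac 'X_1 in y0 *.
have prodE : \prod_c (x / y - iota c) = (x / y) ^+ q - x / y.
  have := congr1 (fun r => (map_poly iota r).[x / y]) (finField_genPoly F).
  rewrite rmorphB /= map_polyXn map_polyX !hornerE => ->.
  rewrite rmorph_prod horner_prod; apply: eq_bigr => c _.
  by rewrite rmorphB /= map_polyX map_polyC !hornerE.
apply/eqP; rewrite -tofrac_eq; apply/eqP.
rewrite tofracB !tofracM !tofracXn rmorph_prod -/x -/y.
have -> : \prod_c tofrac (linform 1 (- c)) = y ^+ q * \prod_c (x / y - iota c).
  rewrite -prodr_const -big_split; apply: eq_bigr => c _ /=.
  rewrite mulrBr mulrCA mulfV // mulr1 /linform scale1r scaleNr tofracB.
  by rewrite -mul_mpolyC tofracM mulrC.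
rewrite prodE /linform scale0r add0r scale1r expr_div_n -/y.
rewrite mulrBr [_ ^+ q * (_ / _)]mulrCA mulfV ?expf_neq0 // mulr1 mulrBr.
congr (_ - _); first exact: mulrC.
by rewrite mulrCA [y * (x / y)]mulrCA mulfV // mulr1 mulrC.
Qed.

Lemma line_form_linear o : line_form o \is 1.-homog.
Proof. by case: o => [c|]; apply: linform_homog. Qed.

Lemma line_form_neq0 o : line_form o != 0.
Proof. by case: o => [c|]; rewrite linform_neq0 oner_eq0 ?orbT. Qed.

(** Evaluate at v o, a zero of the form of index o: among these forms, only that
    one vanishes there. *)
Lemma line_form_inj o o' : divides (line_form o) (line_form o') -> o = o'.
Proof.
pose v (s : option F) : 'I_2 -> F :=
  fun k => if k == 0 then odflt 1 s else (isSome s)%:R.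
have vE s : (line_form s).@[v s] = 0.
  by case: s => [c|]; rewrite linform_eval /v /=; ring.
case=> k /(congr1 (meval (v o))); rewrite mevalM vE mulr0.
case: o o' {k vE} => [c|] [c'|] //=; rewrite linform_eval /v /= => /eqP.
- by rewrite mul1r mulr1 subr_eq0 => /eqP->.
- by rewrite mul0r mul1r add0r oner_eq0.
- by rewrite mulr1 mulr0 addr0 oner_eq0.
Qed.

Definition Moore_det : S := 'X_0 * 'X_1 ^+ q - 'X_1 * 'X_0 ^+ q.

Lemma Moore_detE : Moore_det = - \prod_o line_form o.
Proof. by rewrite prod_line_form /Moore_det; ring. Qed.

Lemma Moore_det_exp m :
  'X_0 ^+ (q ^ m) * 'X_1 ^+ (q ^ m.+1) - 'X_1 ^+ (q ^ m) * 'X_0 ^+ (q ^ m.+1)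
  = Moore_det ^+ (q ^ m).
Proof.
rewrite exprDn_pchar ?pnat_card_exp // exprNn_pchar ?pnat_card_exp //.
by rewrite !exprMn -!exprM -expnS.
Qed.

Lemma Moore_det_neq0 : Moore_det != 0.
Proof.
rewrite Moore_detE oppr_eq0; apply/prodf_neq0 => o _; exact: line_form_neq0.
Qed.

Lemma Moore_det_divides (h : S) :
  (forall o, divides (line_form o) h) -> divides Moore_det h.
Proof.
move=> line_h.
have [k ->] : divides (\prod_o line_form o ^+ 1) h.
  apply: prod_prime_powers_divides => [o|o o'|o]; last by rewrite expr1.
  - case: o => [c|] /=; apply: linform_prime.
      exact: (line_form_neq0 (Some c)).
    exact: (line_form_neq0 None).
  - exact: line_form_inj.
exists (- k); rewrite Moore_detE mulrNN; congr (_ * _).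
Qed.

End FiniteField.

(** * The basis of the logarithmic module *)

Theorem corollary4p5 (p n q : nat) (hp : prime p) (hn : (1 <= n)%N)
    (hq : q = (p ^ n)%N) (F : finFieldType) (hF : #|F| = q)
    (A : multiarrangement F)
    (hA : forall H : {vspace 'rV[F]_2}, H \in arr A <-> hyperplane H)
    (i : nat) (hi : (0 < i)%N)
    (alpha : arr A -> {mpoly F[2]})
    (halpha : forall H : arr A,
       alpha H \is 1.-homog /\ form_ker (alpha H) = val H)
    (j : arr A -> nat)
    (hj : forall H : arr A, (j H <= q ^ i.+1 - q ^ i)%N)
    (hmu : forall H : arr A, mult A H = (q ^ i + j H)%N) :
  submod_basis (logder A)
    (fun k : 'I_2 =>
       if k == 0 then (\prod_(H : arr A) alpha H ^+ j H) *: theta_pow F (q ^ i)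
       else theta_pow F (q ^ i.+1)).
Proof.
move: hj hmu; rewrite -{}hF => {hq} hj hmu.
set P := (#|F| ^ i)%N; set Q := (#|F| ^ i.+1)%N.
set al := \prod_(H : arr A) _.
have le_PQ : (P <= Q)%N by rewrite leq_exp2l // finNzRing_gt1.
have alpha_lin H : alpha H \is 1.-homog by case: (halpha H).
have alpha_neq0 H : alpha H != 0.
  by rewrite -form_ker_hyperplane // (halpha H).2; apply/hA/valP.
have alpha_prime H : prime_elt (alpha H).
  have [a [b ab]] := linformP (alpha_lin H).
  by have := alpha_neq0 H; rewrite ab; apply: linform_prime.
have alpha_inj H H' : divides (alpha H) (alpha H') -> H = H'.
  by rewrite form_ker_divides // !(halpha _).2 => /val_inj.
have alpha_line (a : {mpoly F[2]}) : a \is 1.-homog -> a != 0 ->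
    exists2 H : arr A, form_ker a = val H & divides a (alpha H).
  move=> a_lin a0.
  have aA : form_ker a \in arr A by apply/hA; rewrite form_ker_hyperplane.
  exists [` aA]%fset => //.
  by apply/form_ker_divides => //; rewrite (halpha _).2.
have al_neq0 : al != 0 by apply/prodf_neq0 => H _; rewrite expf_neq0.
have detE : theta_pow F P 0 0 * theta_pow F Q 0 1
          - theta_pow F P 0 1 * theta_pow F Q 0 0 = Moore_det F ^+ P.
  by rewrite !mxE Moore_det_exp.
have det_neq0 : theta_pow F P 0 0 * theta_pow F Q 0 1
              - theta_pow F P 0 1 * theta_pow F Q 0 0 != 0.
  by rewrite detE expf_neq0 // Moore_det_neq0.
(* It suffices to divide the product of the alpha H ^+ P, and the form of every
   line divides the product of the alpha H. *)
have dvd_exp_alpha h : (forall H, divides (alpha H ^+ P) h) ->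
    divides (Moore_det F ^+ P) h.
  move=> hP; apply: (@divides_trans _ _ (\prod_H alpha H ^+ P)).
    rewrite prodrXl; apply/dividesX/Moore_det_divides => o.
    have [H _ oH] := alpha_line _ (line_form_linear o) (line_form_neq0 o).
    exact: divides_trans oH (divides_prod alpha H).
  exact: prod_prime_powers_divides.
have dvd_al h : (forall H, divides (alpha H ^+ (P + j H)) h) ->
    divides (al * Moore_det F ^+ P) h.
  move=> /(prod_prime_powers_divides alpha_prime alpha_inj).
  apply: divides_trans; under eq_bigr do rewrite exprD.
  rewrite big_split /= mulrC.
  have [k ->] : divides (Moore_det F ^+ P) (\prod_H alpha H ^+ P).
    apply: dvd_exp_alpha => H; exact: (divides_prod (fun H => alpha H ^+ P) H).
  by exists k; rewrite mulrA.
split=> [v|c]; last first.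
  rewrite sum_ord2 /= scalerA => /cramer_free[] // /eqP.
  by rewrite mulf_eq0 (negPf al_neq0) orbF => /eqP c0 c1; apply: ord2P.
split=> [vD|[c ->] a a_lin a0]; last first.
  rewrite sum_ord2 /= !(derivation_appD, derivation_appZ) !theta_pow_linform //.
  have [H -> aH] := alpha_line a a_lin a0; rewrite ext_mult_val hmu.
  apply: dividesD; apply: dividesM; last first.
    by apply: divides_exp2l; rewrite -leq_subRL.
  rewrite addnC exprD /P.
  have [k alE] := divides_trans (dividesX (j H) aH)
    (divides_prod (fun H => alpha H ^+ j H) H).
  by exists k; rewrite /al alE mulrA.
have vdvd H : divides (alpha H ^+ (P + j H)) (derivation_app v (alpha H)).
  by rewrite -hmu -ext_mult_val -(halpha H).2; apply: vD.
have [||c0 [c1 ->]] := @cramer_span _ al _ _ v det_neq0.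
- rewrite detE; apply: dvd_exp_alpha => H.
  have [a [b ab]] := linformP (alpha_lin H); have := alpha_neq0 H; rewrite ab.
  move=> ab0; apply: (det_divides ab0).
    by rewrite !mxE linform_exp; apply: divides_exp2l.
  rewrite -derivation_linform -ab; apply: divides_trans (vdvd H).
  exact/divides_exp2l/leq_addr.
- rewrite detE; apply: dvd_al => H.
  have [a [b ab]] := linformP (alpha_lin H); have := alpha_neq0 H; rewrite ab.
  move=> ab0; apply: (det_divides ab0).
    by rewrite -derivation_linform -ab.
  by rewrite !mxE linform_exp; apply: divides_exp2l; rewrite -leq_subRL.
by exists (fun k => if k == 0 then c0 else c1); rewrite sum_ord2.
Qed.
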